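(* Let $f:\mathbb{R}^n\to\mathbb{R}$ be convex and $L$-smooth, $Q=\mathbb{R}^n$ and $h(x)=\frac{R_y^2}{\varepsilon}\|Ax\|_2^2$, where $\varepsilon>0$. Assume that full gradients of $f$ and $h$ are available. Then STM_IPS applied to the penalized problem $$\min_{x\in\mathbb{R}^n}\left\{F(x)=f(x)+\frac{R_y^2}{\varepsilon}\|Ax\|_2^2\right\}$$ requires $$O\left(\sqrt{\frac{LR^2}{\varepsilon}}\right)\ \text{calculations of }\nabla f(x)\qquad\text{and}\qquad\widetilde O\left(\sqrt{\frac{LR^2}{\varepsilon}\chi(A^\top A)}\right)\ \text{calculations of }A^\top Ax$$ to produce a point $x^N$ such that $F(x^N)-\min_{x\in\mathbb{R}^n}F(x)\le\varepsilon$.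
   Context: The original problem is $\min\{f(x):Ax=0\}$ with $A\in\mathbb{R}^{n\times n}$, $A\succeq0$, $\mathrm{Ker}A\ne\{0\}$. Its dual is $\min_y\psi(y)$, $\psi(y)=\max_{x\in\mathbb{R}^n}\{\langle y,Ax\rangle-f(x)\}$; $y^*$ is the solution of the dual of smallest Euclidean norm and $R_y=\|y^*\|_2$. $\chi(A^\top A)=\lambda_{\max}(A^\top A)/\lambda_{\min}^+(A^\top A)$ (ratio of the maximal to the minimal positive eigenvalue). $R=\|x^0-x^*\|_2$, where $x^0$ is the starting point and $x^*$ is the minimizer of $F$ closest to $x^0$. $\widetilde O$ hides constants and polylogarithmic factors of the parameters of the method and the problem. STM_IPS (Similar Triangles Method with Inexact Proximal Step), for minimizing $f+h$: $\tilde x^0=z^0=x^0$, $\alpha_0=A_0=0$. For $k=0,\dots,N-1$: choose $\alpha_{k+1}>0$ with $A_k+\alpha_{k+1}=2L\alpha_{k+1}^2$, $A_{k+1}=A_k+\alpha_{k+1}$; $\tilde x^{k+1}=(A_kx^k+\alpha_{k+1}z^k)/A_{k+1}$; let $g_{k+1}(z)=\frac12\|z^k-z\|_2^2+\alpha_{k+1}\left(f(\tilde x^{k+1})+\langle\nabla f(\tilde x^{k+1}),z-\tilde x^{k+1}\rangle+h(z)\right)$ with minimizer $\hat z^{k+1}$, and find $z^{k+1}$ with $g_{k+1}(z^{k+1})-g_{k+1}(\hat z^{k+1})\le\delta_{k+1}$; $x^{k+1}=(A_kx^k+\alpha_{k+1}z^{k+1})/A_{k+1}$. Here $\delta_{k+1}=\delta\|z^k-\hat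 z^{k+1}\|_2^2$ (alternatively, $\delta_{k+1}=\delta\widetilde R_{k+1}^2$ with $\widetilde R_{k+1}=\max_{0\le j\le k+1}\|z^j-x^*\|_2$, which yields the same guarantees), with $\delta>0$ a suitably small accuracy parameter. The auxiliary problems $\min_zg_{k+1}(z)$ are solved by the (exact, deterministic) Similar Triangles Method as an inner subroutine, started from a suitable point; each inner iteration uses one gradient of $h$, i.e. one calculation of $A^\top Ax$, and the gradient $\nabla f(\tilde x^{k+1})$ is computed once per outer iteration. Similar Triangles Method (STM) for a $\bar\mu$-strongly convex, $\bar L$-smooth $g$ with starting point $u^0$: $z^0=x^0=\tilde x^0=u^0$, $\alpha_0=A_0=0$; $A_{k+1}=A_k+\alpha_{k+1}$, $A_{k+1}(1+A_k\bar\mu)=\bar L\alpha_{k+1}^2$; $\tilde x^{k+1}=(A_kx^k+\alpha_{k+1}z^k)/A_{k+1}$; $z^{k+1}=\mathrm{argmin}_z\{\frac12\|z-z^0\|_2^2+\sum_{l=0}^{k+1}\alpha_l(\langle\nabla g(\tilde x^l),z-\tilde x^l\rangle+\frac{\bar\mu}2\|z-\tilde x^l\|_2^2)\}$; $x^{k+1}=(A_kx^k+\alpha_{k+1}z^{k+1})/A_{k+1}$. *)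

(* Defs.v *)
From HB Require Import structures.
From mathcomp Require Import all_boot all_order all_algebra.
From mathcomp Require Import all_classical all_reals all_analysis.

Set Implicit Arguments.
Unset Strict Implicit.
Unset Printing Implicit Defensive.

Import Order.TTheory GRing.Theory Num.Theory.
Import numFieldNormedType.Exports.

Local Open Scope classical_set_scope.
Local Open Scope ring_scope.

(* The library norm on matrices is the sup norm, hence the separate Euclidean
   inner product and norm; both norms induce the same topology, so the library
   notion of differentiability on 'cV[R]_n is the usual one. *)
Definition dot (R : realType) (n : nat) (u v : 'cV[R]_n) : R :=
  \sum_i u i 0 * v i 0.

Definition enorm (R : realType) (n : nat) (u : 'cV[R]_n) : R :=
  Num.sqrt (dot u u).

Definition grad (R : realType) (n : nat) (f : 'cV[R]_n -> R) (x : 'cV[R]_n) :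
    'cV[R]_n :=
  \col_i 'D_(delta_mx i 0) f x.

Definition smooth (R : realType) (n : nat) (L : R) (f : 'cV[R]_n -> R) : Prop :=
  (forall x, differentiable f x) /\
  (forall x y, enorm (grad f x - grad f y) <= L * enorm (x - y)).

Definition is_argmin (R : realType) (n : nat) (g : 'cV[R]_n -> R)
    (z : 'cV[R]_n) : Prop :=
  forall w, g z <= g w.

(* Only meaningful when g has a unique minimizer; all the functions it is
   applied to below are strongly convex. *)
Definition argmin (R : realType) (n : nat) (g : 'cV[R]_n -> R) : 'cV[R]_n :=
  xget 0 [set z | is_argmin g z].

Definition closest_minimizer (R : realType) (n : nat) (F : 'cV[R]_n -> R)
    (x0 xs : 'cV[R]_n) : Prop :=
  is_argmin F xs /\ forall x, is_argmin F x -> enorm (x0 - xs) <= enorm (x0 - x).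

Definition psd (R : realType) (n : nat) (A : 'M[R]_n) : Prop :=
  A^T = A /\ forall x : 'cV[R]_n, 0 <= dot x (A *m x).

Definition is_max_eigenvalue (R : realType) (n : nat) (M : 'M[R]_n) (a : R) :
    Prop :=
  eigenvalue M a /\ forall b, eigenvalue M b -> b <= a.

Definition is_min_pos_eigenvalue (R : realType) (n : nat) (M : 'M[R]_n)
    (a : R) : Prop :=
  [/\ 0 < a, eigenvalue M a & forall b, 0 < b -> eigenvalue M b -> a <= b].

(* psi(y) = sup_x (<y, A x> - f x) is +oo outside its domain. *)
Definition dual_fun (R : realType) (n : nat) (f : 'cV[R]_n -> R) (A : 'M[R]_n)
    (y : 'cV[R]_n) : \bar R :=
  ereal_sup [set (dot y (A *m x) - f x)%:E | x in [set: 'cV[R]_n]].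

Definition dual_solution (R : realType) (n : nat) (f : 'cV[R]_n -> R)
    (A : 'M[R]_n) (y : 'cV[R]_n) : Prop :=
  dual_fun f A y \is a fin_num /\
  forall y', (dual_fun f A y <= dual_fun f A y')%E.

Definition min_norm_dual_solution (R : realType) (n : nat) (f : 'cV[R]_n -> R)
    (A : 'M[R]_n) (y : 'cV[R]_n) : Prop :=
  dual_solution f A y /\
  forall y', dual_solution f A y' -> enorm y <= enorm y'.

(* The increment a = alpha_{k+1} > 0 with A_{k+1} (1 + A_k mu) = Lb a^2, where
   A_{k+1} = A_k + a; it is unique if A_k, mu >= 0 and Lb > 0. *)
Definition step_size (R : realType) (mu Lb A : R) : R :=
  xget 0 [set a | 0 < a /\ (A + a) * (1 + A * mu) = Lb * a ^+ 2].

(* [stm_model] is the function whose minimizer is z^k: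
   |z - z^0|^2 / 2 + the sum over l <= k of
   alpha_l (<grad g (xt^l), z - xt^l> + mu / 2 |z - xt^l|^2);
   its l = 0 term vanishes because alpha_0 = 0. *)
Record stm_state (R : realType) (n : nat) := StmState {
  stm_A : R;
  stm_x : 'cV[R]_n;
  stm_z : 'cV[R]_n;
  stm_model : 'cV[R]_n -> R }.

Definition stm_init (R : realType) (n : nat) (u0 : 'cV[R]_n) : stm_state R n :=
  StmState 0 u0 u0 (fun z => 2^-1 * enorm (z - u0) ^+ 2).

Definition stm_step (R : realType) (n : nat) (g : 'cV[R]_n -> R) (mu Lb : R)
    (s : stm_state R n) : stm_state R n :=
  let a := step_size mu Lb (stm_A s) in
  let A' := stm_A s + a in
  let xt := A'^-1 *: (stm_A s *: stm_x s + a *: stm_z s) in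
  let model' z := stm_model s z +
    a * (dot (grad g xt) (z - xt) + mu / 2 * enorm (z - xt) ^+ 2) in
  let z' := argmin model' in
  StmState A' (A'^-1 *: (stm_A s *: stm_x s + a *: z')) z' model'.

Definition stm (R : realType) (n : nat) (g : 'cV[R]_n -> R) (mu Lb : R)
    (u0 : 'cV[R]_n) (t : nat) : 'cV[R]_n :=
  stm_x (iter t (stm_step g mu Lb) (stm_init u0)).

(* State of STM_IPS, with the numbers of gradients of f and of h computed so
   far. *)
Record ips_state (R : realType) (n : nat) := IpsState {
  ips_A : R;
  ips_x : 'cV[R]_n;
  ips_z : 'cV[R]_n;
  ips_nf : nat;
  ips_nh : nat }.

Definition ips_init (R : realType) (n : nat) (x0 : 'cV[R]_n) : ips_state R n :=
  IpsState 0 x0 x0 0 0.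

(* A_k + alpha_{k+1} = 2 L alpha_{k+1}^2. *)
Definition ips_alpha (R : realType) (n : nat) (L : R) (s : ips_state R n) : R :=
  step_size 0 (2 * L) (ips_A s).

Definition ips_xt (R : realType) (n : nat) (L : R) (s : ips_state R n) :
    'cV[R]_n :=
  (ips_A s + ips_alpha L s)^-1 *:
    (ips_A s *: ips_x s + ips_alpha L s *: ips_z s).

(* The auxiliary objective g_{k+1}. *)
Definition ips_g (R : realType) (n : nat) (f h : 'cV[R]_n -> R) (L : R)
    (s : ips_state R n) (z : 'cV[R]_n) : R :=
  let xt := ips_xt L s in
  2^-1 * enorm (ips_z s - z) ^+ 2 +
    ips_alpha L s * (f xt + dot (grad f xt) (z - xt) + h z).

(* Inner STM after t iterations. The strong convexity and smoothness constants
   it is run with depend on alpha_{k+1}. The starting point is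
   u0 = z^k - grad g_{k+1} (z^k). For h z = c |A z|^2 with A symmetric, the
   component of u0 in Ker A is that of the minimizer of g_{k+1}, and all
   the gradients of g_{k+1} met by the inner method lie in Im A, so that the
   inner iterates stay in u0 + Im A; moreover u0 is the minimizer as soon as
   z^k is. *)
Definition ips_inner (R : realType) (n : nat) (f h : 'cV[R]_n -> R) (L : R)
    (mu Lb : R -> R) (s : ips_state R n) (t : nat) : 'cV[R]_n :=
  let g := ips_g f h L s in
  let a := ips_alpha L s in
  stm g (mu a) (Lb a) (ips_z s - grad g (ips_z s)) t.

Definition ips_accurate (R : realType) (n : nat) (f h : 'cV[R]_n -> R) (L : R)
    (delta : R) (s : ips_state R n) (z : 'cV[R]_n) : Prop :=
  let g := ips_g f h L s in
  let zhat := argmin g in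
  g z - g zhat <= delta * enorm (ips_z s - zhat) ^+ 2.

Definition ips_stops (R : realType) (n : nat) (f h : 'cV[R]_n -> R) (L : R)
    (mu Lb : R -> R) (delta : R) (s : ips_state R n) (t : nat) : Prop :=
  ips_accurate f h L delta s (ips_inner f h L mu Lb s t) /\
  forall t', (t' < t)%N ->
    ~ ips_accurate f h L delta s (ips_inner f h L mu Lb s t').

(* One outer iteration with t inner ones: it uses grad f only at xt^{k+1};
   grad h is used once to form the starting point of the inner method and once
   in each of the t evaluations of grad g_{k+1} by that method. *)
Definition ips_step (R : realType) (n : nat) (f h : 'cV[R]_n -> R) (L : R)
    (mu Lb : R -> R) (s : ips_state R n) (t : nat) : ips_state R n :=
  let a := ips_alpha L s in
  let A' := ips_A s + a in
  let z' := ips_inner f h L mu Lb s t in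
  IpsState A' (A'^-1 *: (ips_A s *: ips_x s + a *: z')) z'
    (ips_nf s).+1 (ips_nh s + t.+1)%N.

(* k outer iterations; [T j] is the number of inner iterations spent on the
   (j+1)-st auxiliary problem. *)
Fixpoint stm_ips (R : realType) (n : nat) (f h : 'cV[R]_n -> R) (L : R)
    (mu Lb : R -> R) (x0 : 'cV[R]_n) (T : nat -> nat) (k : nat) :
    ips_state R n :=
  match k with
  | 0 => ips_init x0
  | j.+1 => ips_step f h L mu Lb (stm_ips f h L mu Lb x0 T j) (T j)
  end.

Definition stm_ips_run (R : realType) (n : nat) (f h : 'cV[R]_n -> R) (L : R)
    (mu Lb : R -> R) (delta : R) (x0 : 'cV[R]_n) (T : nat -> nat) (N : nat) :
    Prop :=
  forall k, (k < N)%N ->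
    ips_stops f h L mu Lb delta (stm_ips f h L mu Lb x0 T k) (T k).

Definition penalty (R : realType) (n : nat) (A : 'M[R]_n) (c : R)
    (x : 'cV[R]_n) : R :=
  c * enorm (A *m x) ^+ 2.

(* Curvature of |z^k - z|^2 / 2 + a c |A z|^2 along an eigenvector of A^T A for
   the eigenvalue lam. With lam = lambda_max it is the smoothness constant of
   g_{k+1}; with lam = lambda_min^+ it is the strong convexity constant of
   g_{k+1} on the translates of Im A (on the whole space the constant is only
   1, since Ker A is nontrivial). *)
Definition penalty_curvature (R : realType) (c lam a : R) : R :=
  1 + 2 * a * c * lam.

(* Main.v *)
Require Import Defs.
From HB Require Import structures.
From mathcomp Require Import all_boot all_order all_algebra.
From mathcomp Require Import all_classical all_reals all_analysis.
From mathcomp Require Import ring lra.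

Set Implicit Arguments.
Unset Strict Implicit.
Unset Printing Implicit Defensive.

Import Order.TTheory GRing.Theory Num.Theory.
Import numFieldNormedType.Exports.

Local Open Scope classical_set_scope.
Local Open Scope ring_scope.

(** Each auxiliary problem is a strongly convex quadratic with Hessian
    1 + 2 a c A^T A, where a is the current step and c = Ry^2 / eps, and the
    proof has an inner and an outer half.

    Inner half.  The gradients of the auxiliary objective g at points of
    zhat + Im A, where zhat is its minimizer, lie in Im A, and the starting
    point belongs to that affine set; so all the inner iterates stay in it.
    There the strong convexity constant is 1 + 2 a c lmin rather than 1, and the
    linear rate of the inner method is governed by the square root of
    (1 + 2 a c lmax) / (1 + 2 a c lmin) <= chi.  The classical estimating
    sequence argument only uses strong convexity between a query point and the
    minimizer, hence works on an affine set ([stm_gap]).  The starting point is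
    at distance at most 2 a c lmax |z^k - zhat| from zhat, so the relative
    accuracy delta |z^k - zhat|^2 is reached after sqrt(chi) times a logarithm
    many iterations, and after none if z^k = zhat ([inner_stm_accurate]).
    The bounds lmin |w|^2 <= |A w|^2 (on Im A) and |A w|^2 <= lmax |w|^2 come
    from minimizing a quadratic form on the unit sphere of an invariant
    subspace, where a minimizer is an eigenvector ([rayleigh_min]).

    Outer half.  The step equation carries the constant 2 L where L-smoothness
    would allow L.  This leaves a surplus of |z^{k+1} - z^k|^2 / 4 in each
    iteration, which pays for the inexactness except for a term
    4 delta |x* - z^k|^2.  Hence the energy
      A_k (F (x^k) - min F) + |x* - z^k|^2 / 2
    grows by a factor of at most 1 + 8 delta per iteration
    ([ips_step_descent]); with delta = 1 / (64 N) it at most doubles over N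
    iterations.  As A_N >= N^2 / (8 L), taking for N the least integer above
    3 sqrt(L R0^2 / eps) brings the gap below eps.  The steps are at
    most N / (2 L), so the logarithm of the inner half is controlled by the
    parameters of the problem ([inner_target_le]). *)

(** * The Euclidean inner product *)

Section InnerProduct.
Variables (R : realType) (n : nat).
Implicit Types (u v w : 'cV[R]_n) (A : 'M[R]_n) (k : R).

Lemma dotC u v : dot u v = dot v u.
Proof. by apply: eq_bigr => i _; rewrite mulrC. Qed.

Lemma dotDl u v w : dot (u + v) w = dot u w + dot v w.
Proof.
by rewrite -big_split; apply: eq_bigr => i _; rewrite mxE mulrDl.
Qed.

Lemma dotZl k u v : dot (k *: u) v = k * dot u v.
Proof. by rewrite mulr_sumr; apply: eq_bigr => i _; rewrite mxE mulrA. Qed.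

Lemma dotNl u v : dot (- u) v = - dot u v.
Proof. by rewrite -scaleN1r dotZl mulN1r. Qed.

Lemma dotDr u v w : dot w (u + v) = dot w u + dot w v.
Proof. by rewrite dotC dotDl !(dotC w). Qed.

Lemma dotZr k u v : dot u (k *: v) = k * dot u v.
Proof. by rewrite dotC dotZl dotC. Qed.

Lemma dotNr u v : dot u (- v) = - dot u v.
Proof. by rewrite dotC dotNl dotC. Qed.

Definition dotE := (dotDl, dotDr, dotNl, dotNr, dotZl, dotZr).

Lemma dot0l u : dot 0 u = 0.
Proof. by rewrite -(scale0r 0) dotZl mul0r. Qed.

Lemma dot_ge0 u : 0 <= dot u u.
Proof. by apply: sumr_ge0 => i _; rewrite -expr2 sqr_ge0. Qed.

Lemma dot_eq0 u : (dot u u == 0) = (u == 0).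
Proof.
apply/eqP/eqP => [|->]; last exact: dot0l.
move=> /eqP; rewrite psumr_eq0 => [/allP u0|i _]; last first.
  by rewrite -expr2 sqr_ge0.
apply/colP => i; rewrite mxE; apply/eqP.
by have := u0 i (mem_index_enum i); rewrite mulf_eq0 orbb.
Qed.

Lemma dot_gt0 u : (0 < dot u u) = (u != 0).
Proof. by rewrite lt0r dot_eq0 dot_ge0 andbT. Qed.

Lemma sqr_enorm u : enorm u ^+ 2 = dot u u.
Proof. by rewrite sqr_sqrtr ?dot_ge0. Qed.

Lemma dot_delta u i : dot u (delta_mx i 0) = u i 0.
Proof.
rewrite /dot (bigD1 i) //= mxE !eqxx mulr1 big1 ?addr0 // => j ji.
by rewrite mxE (negbTE ji) mulr0.
Qed.

Lemma dot_mulmxl A u v : dot (A *m u) v = dot u (A^T *m v).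
Proof.
have dotE' x y : dot x y = (x^T *m y) 0 0.
  by rewrite mxE; apply: eq_bigr => i _; rewrite mxE.
by rewrite !dotE' trmx_mul mulmxA.
Qed.

Lemma dot_le_of_enorm k u v :
  0 <= k -> enorm u <= k * enorm v -> dot u v <= k * dot v v.
Proof.
move=> k0 uv; have uu : dot u u <= k ^+ 2 * dot v v.
  by rewrite -!sqr_enorm -exprMn lerXn2r // ?nnegrE ?mulr_ge0 ?sqrtr_ge0.
have [k_gt0|] := ltP 0 k; last first.
  move=> k_le0; have k_0 : k = 0 by apply: le_anti; rewrite k0 k_le0.
  move: uu; rewrite k_0 expr2 !mul0r => uu.
  have -> : u = 0 by apply/eqP; rewrite -dot_eq0 eq_le uu dot_ge0.
  by rewrite dot0l.
have := dot_ge0 (u - k *: v); rewrite !dotE (dotC v u) => H.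
rewrite -(ler_pM2l k_gt0); nra.
Qed.

End InnerProduct.

(** * Rayleigh quotients *)

Lemma continuous_trmx_coord (R : realType) n i :
  continuous (fun u : 'rV[R]_n => u^T i 0).
Proof.
have -> : (fun u : 'rV[R]_n => u^T i 0) = (fun u => u 0 i).
  by apply/funext => u; rewrite mxE.
exact: coord_continuous.
Qed.

Lemma continuous_mulmx_coord (R : realType) m n (B : 'M[R]_(m, n)) i :
  continuous (fun u : 'rV[R]_n => (B *m u^T) i 0).
Proof.
under eq_fun do rewrite mxE.
apply: (@continuous_big R^o _ +%R 0 xpredT) => [|j _].
  exact: (@add_continuous R^o).
move=> u; apply: continuousM; first exact: cst_continuous.
exact: continuous_trmx_coord.
Qed.

Lemma continuous_dot_mulmx (R : realType) n (M : 'M[R]_n) :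
  continuous (fun u : 'rV[R]_n => dot u^T (M *m u^T)).
Proof.
apply: (@continuous_big R^o _ +%R 0 xpredT) => [|i _].
  exact: (@add_continuous R^o).
move=> u; apply: continuousM; last exact: continuous_mulmx_coord.
exact: continuous_trmx_coord.
Qed.

(** Row vectors, because compactness of cubes is stated for them. *)
Lemma compact_sphere_ker (R : realType) m n (B : 'M[R]_(m, n)) :
  compact [set u : 'rV[R]_n | B *m u^T = 0 /\ dot u^T u^T = 1].
Proof.
have cube : compact [set u : 'rV[R]_n | forall i, u ord0 i \in `[-1, 1]].
  apply: (@rV_compact R n (fun=> (`[-1, 1]%classic : set R))) => _.
  exact: segment_compact.
apply: (subclosed_compact _ cube) => [|u /= [_ u1] i]; last first.
  have : u ord0 i ^+ 2 <= 1.
    rewrite -u1 /dot (bigD1 i) //= !mxE -expr2 lerDl.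
    by apply: sumr_ge0 => j _; rewrite -expr2 sqr_ge0.
  rewrite in_itv /= -ler_norml => ui1.
  by rewrite -(@expr_le1 _ 2) // real_normK // num_real.
have -> : [set u : 'rV[R]_n | B *m u^T = 0 /\ dot u^T u^T = 1] =
    (\bigcap_(i in [set: 'I_m]) [set u | (B *m u^T) i 0 = 0]) `&`
    [set u | dot u^T (1%:M *m u^T) = 1].
  apply/seteqP; split=> [u /= [Bu u1]|u /= [Bu]]; rewrite mul1mx.
    by split=> // i _; rewrite /= Bu mxE.
  by split=> //; apply/colP => i; rewrite [RHS]mxE; exact: Bu.
apply: closedI.
  apply: closed_bigI => i _.
  have /continuous_closedP/(_ [set 0]) := @continuous_mulmx_coord R _ _ B i.
  by apply; exact: closed_eq.
have /continuous_closedP/(_ [set 1]) := @continuous_dot_mulmx R n 1%:M.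
by apply; exact: closed_eq.
Qed.

(** A minimizer of the form of M on the unit sphere of the M-stable subspace
    defined by B w = 0 is an eigenvector: first-order optimality is tested in the
    direction of the residual M v - a v, which belongs to the subspace. *)
Lemma rayleigh_min (R : realType) m n (M : 'M[R]_n) (B : 'M[R]_(m, n))
    (v0 : 'cV[R]_n) :
  M^T = M -> (forall v : 'cV[R]_n, B *m v = 0 -> B *m (M *m v) = 0) ->
  v0 != 0 -> B *m v0 = 0 ->
  exists (a : R) (v : 'cV[R]_n), [/\ v != 0, B *m v = 0, M *m v = a *: v &
    forall w, B *m w = 0 -> a * dot w w <= dot w (M *m w)].
Proof.
move=> symM stabM v0_neq0 Bv0.
set S := [set u : 'rV[R]_n | B *m u^T = 0 /\ dot u^T u^T = 1].
have normalize (w : 'cV[R]_n) : w != 0 -> exists2 k : R, k != 0 & dot (k *: w) (k *: w) = 1.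
  move=> w0; exists (enorm w)^-1; first by rewrite invr_eq0 sqrtr_eq0 -ltNge dot_gt0.
  by rewrite !dotE mulrA -expr2 exprVn sqr_enorm mulVf // dot_eq0.
have S0 : S !=set0.
  have [k _ k1] := normalize _ v0_neq0.
  by exists (k *: v0)^T; rewrite /S /= trmxK k1 -scalemxAr Bv0 scaler0.
have [u] := EVT_min_rV S0 (compact_sphere_ker (B := B))
  (continuous_subspaceT (@continuous_dot_mulmx R n M)).
rewrite inE => -[Bv v1] min_u; set v := u^T in Bv v1 min_u.
set a := dot v (M *m v) in min_u.
have ge_a (w : 'cV[R]_n) : B *m w = 0 -> a * dot w w <= dot w (M *m w).
  move=> Bw; have [->|w0] := eqVneq w 0; first by rewrite !dot0l mulr0.
  have [k k0 k1] := normalize _ w0.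
  have := min_u (k *: w)^T; rewrite inE /S /= trmxK.
  rewrite -scalemxAr Bw scaler0 => /(_ (conj erefl k1)) min_w.
  have k2 : 0 < k ^+ 2 by rewrite exprn_even_gt0.
  rewrite -(ler_pM2l k2) mulrCA.
  have -> : k ^+ 2 * dot w w = 1 by rewrite -k1 !dotE mulrA.
  by move: min_w; rewrite mulr1 -scalemxAr !dotE mulrA -expr2.
have Mdot x y : dot x (M *m y) = dot y (M *m x).
  by rewrite dotC dot_mulmxl symM.
exists a, v; split=> //.
  by apply: contra_eq_neq v1 => ->; rewrite dot0l eq_sym oner_eq0.
have [r rE] : exists r, r = M *m v - a *: v by exists (M *m v - a *: v).
have Br : B *m r = 0 by rewrite rE mulmxBr stabM // -scalemxAr Bv scaler0 subr0.
pose K := dot r (M *m r) - a * dot r r.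
have K0 : 0 <= K by rewrite subr_ge0 ge_a.
(* The form of M - a is nonnegative on v + t r and vanishes at t = 0, where its
   derivative is 2 |r|^2. *)
have perturb t : 0 <= 2 * t * dot r r + t ^+ 2 * K.
  have : B *m (v + t *: r) = 0 by rewrite mulmxDr -scalemxAr Br scaler0 Bv addr0.
  move/ge_a; rewrite -subr_ge0 mulmxDr -scalemxAr !dotE (Mdot v r) (dotC v r).
  rewrite -/a v1.
  have rr : dot r r = dot r (M *m v) - a * dot r v by rewrite {2}rE !dotE.
  move=> ge0; rewrite {1}rr; move: ge0.
  by congr (_ <= _); rewrite /K; ring.
have r0 : dot r r = 0.
  apply/eqP; rewrite eq_le dot_ge0 andbT.
  have := perturb (- (dot r r / (K + 1))); set x := dot r r.
  set y := x / (K + 1).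
  have xE : x = y * (K + 1) by rewrite /y divfK // gt_eqF // ltr_wpDl.
  rewrite xE => H; have y2 : y ^+ 2 <= 0 by nra.
  have -> : y = 0 by apply/eqP; rewrite -sqrf_eq0 eq_le y2 sqr_ge0.
  by rewrite mul0r.
by apply/eqP; rewrite -subr_eq0 -rE -dot_eq0 r0.
Qed.

Lemma eigenvalue_sym (R : realType) n (M : 'M[R]_n) (a : R) (v : 'cV[R]_n) :
  M^T = M -> v != 0 -> M *m v = a *: v -> eigenvalue M a.
Proof.
move=> symM v0 Mv; apply/eigenvalueP; exists v^T.
  by rewrite -{1}symM -trmx_mul Mv linearZ.
by rewrite -trmx0 (inj_eq trmx_inj).
Qed.

Lemma dot_gram (R : realType) n (A : 'M[R]_n) (u v : 'cV[R]_n) :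
  dot u (A^T *m A *m v) = dot (A *m u) (A *m v).
Proof. by rewrite dot_mulmxl mulmxA. Qed.

Lemma gram_sym (R : realType) n (A : 'M[R]_n) : (A^T *m A)^T = A^T *m A.
Proof. by rewrite trmx_mul trmxK. Qed.

(** The largest eigenvalue is minus the least one of the opposite matrix. *)
Lemma gram_le_max_eigenvalue (R : realType) n (A : 'M[R]_n) (lmax : R)
    (w : 'cV[R]_n) :
  is_max_eigenvalue (A^T *m A) lmax ->
  dot (A *m w) (A *m w) <= lmax * dot w w.
Proof.
move=> [_ max_lmax]; have [->|w0] := eqVneq w 0.
  by rewrite mulmx0 !dot0l mulr0.
have [||||a [v [v0 _ Mv min_a]]] :=
    @rayleigh_min R n n (- (A^T *m A)) 0 w.
- by rewrite linearN /= gram_sym.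
- by move=> v _; rewrite mul0mx.
- exact: w0.
- exact: mul0mx.
have : eigenvalue (A^T *m A) (- a).
  apply: (eigenvalue_sym (gram_sym A) v0).
  by rewrite scaleNr -Mv mulNmx opprK.
move=> /max_lmax a_lmax; have := min_a w (mul0mx _ _).
rewrite mulNmx dotNr dot_gram => H.
have := ler_wpM2r (dot_ge0 w) a_lmax; lra.
Qed.

(** Since A is symmetric, Im A meets Ker A only in 0, so that the least
    eigenvalue of A^T A on Im A is positive. *)
Lemma gram_ge_min_pos_eigenvalue (R : realType) n (A : 'M[R]_n) (lmin : R)
    (w : 'cV[R]_n) :
  A^T = A -> is_min_pos_eigenvalue (A^T *m A) lmin ->
  lmin * dot (A *m w) (A *m w) <= dot (A *m (A *m w)) (A *m (A *m w)).
Proof.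
move=> symA [lmin0 _ min_lmin].
have [->|w0] := eqVneq (A *m w) 0; first by rewrite mulmx0 !dot0l mulr0.
(* The image of A, cut out by the equations B v = 0. *)
pose B := (cokermx A)^T.
have imP (v : 'cV[R]_n) : B *m v = 0 <-> exists u, v = A *m u.
  have -> : B *m v = (v^T *m cokermx A)^T by rewrite trmx_mul trmxK.
  split=> [vB|[u ->]].
    have /submxP[D vD] : (v^T <= A)%MS.
      by rewrite submxE; apply/eqP/trmx_inj; rewrite vB trmx0.
    by exists D^T; rewrite -[LHS]trmxK vD trmx_mul symA.
  by rewrite (trmx_mul A) symA -mulmxA mulmx_coker mulmx0 trmx0.
have [||||a [v [v0 /imP[u vE] Mv min_a]]] := @rayleigh_min R n n (A^T *m A) B (A *m w).
- exact: gram_sym.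
- by move=> v _; apply/imP; exists (A *m v); rewrite symA -mulmxA.
- exact: w0.
- by apply/imP; exists w.
have Av0 : A *m v != 0.
  apply: contra_neq v0 => Av; apply/eqP; rewrite -dot_eq0 {1}vE dot_mulmxl symA.
  by rewrite Av dotC dot0l.
have a0 : 0 < a.
  have : 0 < a * dot v v by rewrite -dotZr -Mv dot_gram dot_gt0.
  by rewrite pmulr_lgt0 // dot_gt0.
have := min_lmin a a0 (eigenvalue_sym (gram_sym A) v0 Mv).
move=> /(ler_wpM2r (dot_ge0 (A *m w)))/le_trans; apply.
by rewrite -(dot_gram A (A *m w)); apply/min_a/imP; exists w.
Qed.

(** * Gradients *)

(** Computes the gradients of quadratic functions: the difference quotient is
    l + t q exactly. *)
Lemma derive_of_quadratic (R : realType) n (phi : 'cV[R]_n -> R)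
    (x v : 'cV[R]_n) (l q : R) :
  (forall t : R, phi (x + t *: v) = phi x + t * l + t ^+ 2 * q) ->
  'D_v phi x = l.
Proof.
move=> phiE; apply: cvg_lim => //=.
have lin0 : l + h * q @[h --> (0 : R)^'] --> l + 0 * q.
  apply: cvg_within_filter.
  by apply: cvgD; [exact: cvg_cst|apply: cvgMr_tmp; exact: cvg_id].
rewrite mul0r addr0 in lin0.
apply: cvg_trans lin0; apply: near_eq_cvg; near=> h.
have h0 : h != 0 by near: h; exact: nbhs_dnbhs_neq.
rewrite /shift /= (addrC (h *: v)) phiE.
by rewrite /GRing.scale /=; field.
Unshelve. all: by end_near. Qed.

Lemma derive_dot_grad (R : realType) n (f : 'cV[R]_n -> R) (x v : 'cV[R]_n) :
  differentiable f x -> 'D_v f x = dot (grad f x) v.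
Proof.
move=> df; rewrite deriveE // /dot.
under eq_bigr do rewrite mxE deriveE //.
have {1}-> : v = \sum_i v i 0 *: delta_mx i 0.
  apply/colP => j; rewrite summxE (bigD1 j) //= !mxE !eqxx mulr1.
  by rewrite big1 ?addr0 // => i ij; rewrite !mxE eq_sym (negbTE ij) mulr0.
rewrite linear_sum; apply: eq_bigr => i _.
by rewrite linearZ /= mulrC.
Qed.

(** The difference quotients along the segment are at most f y - f x. *)
Lemma convex_ge_tangent (R : realType) n (f : 'cV[R]_n -> R) (x y : 'cV[R]_n) :
  convex_function [set: 'cV[R]_n] f -> differentiable f x ->
  f x + dot (grad f x) (y - x) <= f y.
Proof.
move=> cf df; rewrite -derive_dot_grad // addrC -lerBrDr.
have /cvg_dnbhs_at_right := @diff_derivable _ _ _ f x (y - x) df.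
move=> /cvgr_to_le; apply; near=> h.
have h0 : 0 < h by near: h; exact: nbhs_right_gt.
have h1 : h <= 1 by near: h; exact: nbhs_right_le.
have cfh : f (h *: y + (1 - h) *: x) <= h * f y + (1 - h) * f x.
  by have := cf (Itv01 (ltW h0) h1) y x; rewrite !inE; apply.
rewrite /shift /= /GRing.scale /= mulrC ler_pdivrMr //.
have -> : h *: (y - x) + x = h *: y + (1 - h) *: x.
  by rewrite scalerBr scalerBl scale1r addrAC addrA.
by rewrite lerBlDr (le_trans cfh) // mulrDl mulNr; lra.
Unshelve. all: by end_near. Qed.

Lemma is_derive_along_line (R : realType) n (f : 'cV[R]_n -> R)
    (x v : 'cV[R]_n) (t : R) :
  differentiable f (t *: v + x) ->
  is_derive t 1 (fun s : R => f (s *: v + x)) (dot (grad f (t *: v + x)) v).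
Proof.
move=> df; rewrite -derive_dot_grad //.
set F := fun s : R => f (s *: v + x).
have FE : (fun h : R => h^-1 *: ((F \o shift t) (h *: 1) - F t)) =
    (fun h => h^-1 *: ((f \o shift (t *: v + x)) (h *: v) - f (t *: v + x))).
  by apply/funext => h /=; rewrite /F /= [h%:A]mulr1 scalerDl addrA.
apply: DeriveDef; rewrite /derivable /derive FE //.
exact: diff_derivable.
Qed.

(** Along the segment, f minus the quadratic upper model has a nonpositive
    derivative. *)
Lemma smooth_le_quadratic (R : realType) n (L : R) (f : 'cV[R]_n -> R)
    (x y : 'cV[R]_n) :
  0 <= L -> smooth L f ->
  f y <= f x + dot (grad f x) (y - x) + L / 2 * dot (y - x) (y - x).
Proof.
move=> L0 [df lipf]; set v := y - x.
pose phi (t : R) := f (t *: v + x) - (t * dot (grad f x) v + t ^+ 2 * (L / 2 * dot v v)).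
have dphi (t : R) : is_derive t 1 phi
    (dot (grad f (t *: v + x) - grad f x) v - t * L * dot v v).
  have := is_derive_along_line (df (t *: v + x)).
  move=> ?; apply: is_derive_eq.
  by rewrite dotDl dotNl /GRing.scale /=; field.
suff : phi 1 <= phi 0.
  rewrite /phi !scale1r !scale0r add0r subrK; lra.
apply: (@ler0_derive1_le_cc _ phi 0 1); rewrite ?in_itv /= ?lexx ?ler01 //.
- move=> t; rewrite in_itv /= => /andP[t0 t1]; rewrite derive1E derive_val.
  have := @dot_le_of_enorm _ _ (t * L) (grad f (t *: v + x) - grad f x) v.
  rewrite subr_le0; apply; first by rewrite mulr_ge0 // ltW.
  apply: le_trans (lipf _ _) _.
  rewrite addrK /enorm dotZl dotZr mulrA -expr2 sqrtrM ?sqr_ge0 //.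
  by rewrite sqrtr_sqr gtr0_norm // mulrA (mulrC L).
- apply: continuous_subspaceT => t.
  by apply/differentiable_continuous/derivable1_diffP; apply: ex_derive.
Qed.

(** * Step sizes and minimizers *)

Lemma step_sizeP (R : realType) (mu Lb A : R) :
  0 <= mu -> 0 < Lb -> 0 <= A ->
  0 < step_size mu Lb A /\
  (A + step_size mu Lb A) * (1 + A * mu) = Lb * step_size mu Lb A ^+ 2.
Proof.
move=> mu0 Lb0 A0.
apply: (@xgetPex _ 0 [set a | 0 < a /\ (A + a) * (1 + A * mu) = Lb * a ^+ 2]).
set K := 1 + A * mu; have K0 : 0 < K by rewrite ltr_pwDl // mulr_ge0.
pose D := K ^+ 2 + 4 * Lb * A * K.
have D0 : 0 <= D by rewrite addr_ge0 ?sqr_ge0 // !mulr_ge0 // ltW.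
exists ((K + Num.sqrt D) / (2 * Lb)); split; rewrite -/K.
  by rewrite divr_gt0 ?mulr_gt0 // ltr_wpDr ?sqrtr_ge0.
have sD : Num.sqrt D ^+ 2 = D by rewrite sqr_sqrtr.
have Lb_neq0 : Lb != 0 by rewrite gt_eqF.
have Lb4 : 4 * Lb != 0 by rewrite mulf_neq0 ?pnatr_eq0.
apply: (mulIf Lb4).
have -> : (A + (K + Num.sqrt D) / (2 * Lb)) * K * (4 * Lb) =
  4 * Lb * A * K + 2 * K ^+ 2 + 2 * K * Num.sqrt D by field.
have -> : Lb * ((K + Num.sqrt D) / (2 * Lb)) ^+ 2 * (4 * Lb) =
  K ^+ 2 + 2 * K * Num.sqrt D + Num.sqrt D ^+ 2 by field.
by rewrite sD /D; ring.
Qed.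

Lemma argmin_unique (R : realType) n (g : 'cV[R]_n -> R) (K : R)
    (zs : 'cV[R]_n) :
  0 < K -> (forall z, g zs + K * dot (z - zs) (z - zs) <= g z) ->
  argmin g = zs.
Proof.
move=> K0 g_zs; have zs_min : is_argmin g zs.
  by move=> z; apply: le_trans (g_zs z); rewrite lerDl mulr_ge0 ?dot_ge0 // ltW.
have := @xgetPex _ 0 [set z | is_argmin g z] (ex_intro _ zs zs_min).
rewrite -/(argmin g) => /(_ zs) /= arg_zs.
have := le_trans (g_zs (argmin g)) arg_zs.
rewrite gerDl pmulr_rle0 // => dot0; apply/eqP; rewrite -subr_eq0 -dot_eq0.
by rewrite eq_le dot0 dot_ge0.
Qed.

(** * The similar triangles method on an affine set *)

(** [V] stands for an affine set that contains the iterates; strong convexity is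
    only required at its points, and only towards the minimizer [zs]. *)
Section SimilarTriangles.
Variables (R : realType) (n : nat) (g : 'cV[R]_n -> R) (mu Lb : R).
Variables (V : set 'cV[R]_n) (u0 zs : 'cV[R]_n).
Hypotheses (mu_gt0 : 0 < mu) (Lb_gt0 : 0 < Lb).
Hypothesis g_le : forall x y,
  g y <= g x + dot (grad g x) (y - x) + Lb / 2 * dot (y - x) (y - x).
Hypothesis g_ge : forall x y, g x + dot (grad g x) (y - x) <= g y.
Hypothesis g_strong : forall x, V x ->
  g x + dot (grad g x) (zs - x) + mu / 2 * dot (zs - x) (zs - x) <= g zs.
Hypothesis zs_min : is_argmin g zs.
Hypothesis V_u0 : V u0.
Hypothesis V_affine : forall k x y, V x -> V y -> V (k *: x + (1 - k) *: y).
Hypothesis V_grad : forall x, V x -> V (x - mu^-1 *: grad g x).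

(** The estimating sequence argument: the model plus the constant
    b = \sum_l alpha_l g (xt^l) is at least A g (x) everywhere, because its
    minimum m + b is, and at zs it is at most |zs - u0|^2 / 2 + A g (zs). *)
Let invariant (s : stm_state R n) : Prop :=
  [/\ 0 <= stm_A s, V (stm_x s), V (stm_z s) &
  exists m b : R, [/\
    forall z, stm_model s z =
      m + (1 + stm_A s * mu) / 2 * dot (z - stm_z s) (z - stm_z s),
    stm_A s * g (stm_x s) <= m + b &
    stm_model s zs + b <= 2^-1 * dot (zs - u0) (zs - u0) + stm_A s * g zs]].

Let invariant_init : invariant (stm_init u0).
Proof.
split=> //=; exists 0, 0; split=> [z||].
- by rewrite sqr_enorm /= mul0r addr0 add0r mul1r.
- by rewrite mul0r addr0.
- by rewrite sqr_enorm mul0r.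
Qed.

(* Completing the square: z' is where the gradient of the updated model
   vanishes. *)
Let model_step (K a m : R) (z0 xt G z' z : 'cV[R]_n) :
  K *: (z' - z0) + a *: G + (a * mu) *: (z' - xt) = 0 ->
  m + K / 2 * dot (z - z0) (z - z0) +
    a * (dot G (z - xt) + mu / 2 * dot (z - xt) (z - xt)) =
  m + K / 2 * dot (z' - z0) (z' - z0) +
    a * (dot G (z' - xt) + mu / 2 * dot (z' - xt) (z' - xt)) +
  (K + a * mu) / 2 * dot (z - z') (z - z').
Proof.
move=> crit; have : dot (z - z') 0 = 0 by rewrite dotC dot0l.
rewrite -crit.
have -> : z - z0 = (z - z') + (z' - z0) by rewrite addrA subrK.
have -> : z - xt = (z - z') + (z' - xt) by rewrite addrA subrK.
move: (z - z') (z' - z0) (z' - xt) => w p r.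
rewrite !dotE (dotC p w) (dotC r w) (dotC G w); lra.
Qed.

Let invariant_step s : invariant s -> invariant (stm_step g mu Lb s).
Proof.
case: s => A x z model [/= A0 Vx Vz [m [b [modelE gap_x gap_zs]]]].
rewrite /stm_step /=; set a := step_size mu Lb A.
have [a0 aE] := step_sizeP (ltW mu_gt0) Lb_gt0 A0; rewrite -/a in a0 aE.
have A'0 : 0 < A + a by rewrite ltr_wpDl.
have A'_neq0 : A + a != 0 by rewrite gt_eqF.
set xt := (A + a)^-1 *: (A *: x + a *: z).
set G := grad g xt.
have conv_comb y : (A + a)^-1 *: (A *: x + a *: y) =
    (A / (A + a)) *: x + (1 - A / (A + a)) *: y.
  rewrite scalerDr !scalerA mulrC; congr (_ + _ *: _).
  by field.
have Vxt : V xt by rewrite /xt conv_comb; exact: V_affine.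
have K0 : 0 < 1 + A * mu by rewrite ltr_pwDl // mulr_ge0 // ltW.
have K'0 : 0 < 1 + (A + a) * mu by rewrite ltr_pwDl // mulr_ge0 // ltW.
have K'_neq0 : 1 + (A + a) * mu != 0 by rewrite gt_eqF.
pose k := (1 + A * mu) / (1 + (A + a) * mu).
have [z1 z1E] : exists z1, z1 = k *: z + (1 - k) *: (xt - mu^-1 *: G).
  by eexists.
have crit : (1 + A * mu) *: (z1 - z) + a *: G + (a * mu) *: (z1 - xt) = 0.
  apply/colP => i; rewrite z1E !mxE /k; field.
  by rewrite A'_neq0 K'_neq0 gt_eqF.
set model' := (X in argmin X).
have model'E y : model' y = m + (1 + A * mu) / 2 * dot (y - z) (y - z) +
    a * (dot G (y - xt) + mu / 2 * dot (y - xt) (y - xt)).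
  by rewrite /model' modelE sqr_enorm.
have model'_z1 y : model' y =
    model' z1 + (1 + (A + a) * mu) / 2 * dot (y - z1) (y - z1).
  have -> : 1 + (A + a) * mu = 1 + A * mu + a * mu by ring.
  by rewrite !model'E (model_step _ _ crit).
have -> : argmin model' = z1.
  apply: (@argmin_unique _ _ _ ((1 + (A + a) * mu) / 2)) => [|y].
    by rewrite divr_gt0.
  by rewrite -model'_z1.
have Vz1 : V z1 by rewrite z1E; exact: (V_affine k Vz (V_grad Vxt)).
split=> //=; first exact: ltW.
  by rewrite conv_comb; exact: V_affine.
exists (model' z1), (b + a * g xt); split=> //; last first.
  rewrite sqr_enorm; have := g_strong Vxt; rewrite -/G => H.
  have := ler_wpM2l (ltW a0) H; lra.
(* The new x moves from xt by a / (A + a) times the move of z, and the step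
   equation turns the smoothness error into the growth of the model. *)
set x1 := (A + a)^-1 *: (A *: x + a *: z1).
have x1E : x1 - xt = (a / (A + a)) *: (z1 - z).
  by apply/colP => i; rewrite !mxE; field.
have xE : A *: (x - xt) + a *: (z1 - xt) = a *: (z1 - z).
  by apply/colP => i; rewrite !mxE; field.
have GxE : A * dot G (x - xt) + a * dot G (z1 - xt) = a * dot G (z1 - z).
  by rewrite -!dotZr -dotDr xE.
have le_x1 : (A + a) * g x1 <= (A + a) * g xt + a * dot G (z1 - z) +
    (1 + A * mu) / 2 * dot (z1 - z) (z1 - z).
  have := ler_wpM2l (ltW A'0) (g_le xt x1); move/le_trans; apply.
  rewrite x1E !dotZr dotZl -/G le_eqVlt; apply/orP; left; apply/eqP.
  have -> : 1 + A * mu = Lb * a ^+ 2 / (A + a) by rewrite -aE; field.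
  by field.
have ge_xt := ler_wpM2l A0 (g_ge xt x); rewrite -/G in ge_xt.
have r0 : 0 <= a * (mu / 2 * dot (z1 - xt) (z1 - xt)).
  by rewrite !mulr_ge0 ?dot_ge0 // ltW.
rewrite model'E; lra.
Qed.

Let invariant_iter t : invariant (iter t (stm_step g mu Lb) (stm_init u0)).
Proof. by elim: t => //= t; exact: invariant_step. Qed.

(** From A_{k+1} (1 + mu A_k) = Lb alpha^2 one gets alpha >= q A_k. *)
Let stm_weight_ge (q : R) t : 0 <= q -> Lb * q ^+ 2 <= mu ->
  Lb^-1 * (1 + q) ^+ t <= stm_A (iter t.+1 (stm_step g mu Lb) (stm_init u0)).
Proof.
move=> q0 q_le; elim: t => [|t IHt].
  have [a0 aE] := step_sizeP (ltW mu_gt0) Lb_gt0 (lexx 0).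
  rewrite mulr1 /= add0r; move: a0 aE; set a := step_size _ _ _ => a0.
  rewrite add0r mul0r addr0 mulr1 => aE.
  have -> : Lb = a^-1; last by rewrite invrK.
  by apply: (mulIf (lt0r_neq0 a0)); apply: (mulIf (lt0r_neq0 a0));
    rewrite -mulrA -expr2 -aE mulVf ?mul1r // gt_eqF.
have [A0 _ _ _] := invariant_iter t.+1.
rewrite iterS [iter _ _ _]lock /= -lock.
have [a0 aE] := step_sizeP (ltW mu_gt0) Lb_gt0 A0.
set A := stm_A _ in IHt A0 a0 aE *; set a := step_size _ _ _ in a0 aE *.
have qA_a : q * A <= a.
  rewrite -(@ler_pXn2r _ 2) ?nnegrE ?mulr_ge0 // ?(ltW a0) //.
  rewrite -(ler_pM2l Lb_gt0) -aE.
  have : A ^+ 2 * (Lb * q ^+ 2) <= A ^+ 2 * mu by rewrite ler_wpM2l ?sqr_ge0.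
  have : 0 <= a * (A * mu) by rewrite !mulr_ge0 // ltW.
  lra.
rewrite exprSr mulrA.
have : 0 <= 1 + q by rewrite addr_ge0.
move=> /ler_wpM2r/(_ _ _ IHt)/le_trans; apply; lra.
Qed.

Lemma stm_gap (q : R) t : 0 <= q -> Lb * q ^+ 2 <= mu ->
  (1 + q) ^+ t * (g (stm g mu Lb u0 t.+1) - g zs) <=
  Lb / 2 * dot (zs - u0) (zs - u0).
Proof.
move=> q0 q_le; rewrite /stm; have := stm_weight_ge t q0 q_le.
have := invariant_iter t.+1; case: (iter _ _ _) => A x z model.
move=> [/= A0 _ _ [m [b [modelE gap_x gap_zs]]]] A_ge.
have gap0 : 0 <= g x - g zs by rewrite subr_ge0 zs_min.
have Ax : A * (g x - g zs) <= 2^-1 * dot (zs - u0) (zs - u0).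
  have : 0 <= (1 + A * mu) / 2 * dot (zs - z) (zs - z).
    by rewrite !mulr_ge0 ?dot_ge0 // addr_ge0 // mulr_ge0 // ltW.
  rewrite modelE in gap_zs; lra.
have := le_trans (ler_wpM2r gap0 A_ge) Ax.
by rewrite -(mulrA Lb^-1) ler_pdivrMl // mulrA.
Qed.

End SimilarTriangles.

(** * The auxiliary problem *)

Section AuxiliaryProblem.
Variables (R : realType) (n : nat) (A : 'M[R]_n) (f : 'cV[R]_n -> R).
Variables (L c lmax lmin : R) (s : ips_state R n).
Hypotheses (symA : A^T = A) (c_ge0 : 0 <= c) (L_gt0 : 0 < L).
Hypothesis ips_A_ge0 : 0 <= ips_A s.
Hypothesis lmaxP : is_max_eigenvalue (A^T *m A) lmax.
Hypothesis lminP : is_min_pos_eigenvalue (A^T *m A) lmin.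

Let h := penalty A c.
Let a := ips_alpha L s.
Let g := ips_g f h L s.
Let hess : 'M[R]_n := 1%:M + (2 * a * c) *: (A^T *m A).
Let slope (z : 'cV[R]_n) : 'cV[R]_n :=
  hess *m z - ips_z s + a *: grad f (ips_xt L s).

Let a_gt0 : 0 < a.
Proof. by case: (step_sizeP (lexx 0) (mulr_gt0 (ltr0Sn R 1) L_gt0) ips_A_ge0). Qed.

Let ac_ge0 : 0 <= a * c.
Proof. by rewrite mulr_ge0 // ltW. Qed.

Let hessE (z : 'cV[R]_n) : hess *m z = z + (2 * a * c) *: (A^T *m A *m z).
Proof. by rewrite mulmxDl mul1mx -scalemxAl. Qed.

Let aux_expansion z w :
  g (z + w) = g z + dot (slope z) w +
    (2^-1 * dot w w + a * c * dot (A *m w) (A *m w)).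
Proof.
rewrite /g /ips_g -/a /h /penalty !sqr_enorm /slope hessE mulmxDr.
set G := grad f _; set xt := ips_xt _ _; set zk := ips_z s.
clearbody G xt zk.
have -> : dot (z + (2 * a * c) *: (A^T *m A *m z) - zk + a *: G) w =
    dot (z - zk) w + 2 * a * c * dot (A *m z) (A *m w) + a * dot G w.
  rewrite !dotDl dotNl !dotZl (dotC (A^T *m A *m z)) dot_gram.
  by rewrite (dotC (A *m w)); ring.
rewrite !dotE (dotC w zk) (dotC w z) (dotC z zk) (dotC (A *m w) (A *m z)).
by field.
Qed.

Let grad_aux z : grad g z = slope z.
Proof.
apply/colP => i; rewrite mxE -[RHS]dot_delta.
set e := delta_mx i 0.
apply: (@derive_of_quadratic _ _ _ _ _ _
  (2^-1 * dot e e + a * c * dot (A *m e) (A *m e))) => t.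
by rewrite aux_expansion -scalemxAr !dotE; ring.
Qed.

Let slope_zero : exists zs, slope zs = 0.
Proof.
have hess_unit : hess \in unitmx.
  rewrite -row_free_unit; apply: inj_row_free => u uH.
  have : hess *m u^T = 0.
    rewrite -[hess]trmxK -trmx_mul; apply/eqP; rewrite trmx_eq0; apply/eqP.
    by rewrite linearD /= linearZ /= trmx1 gram_sym.
  move=> /(congr1 (dot u^T)); rewrite hessE !dotE dot_gram dotC dot0l.
  have := dot_ge0 u^T; have := mulr_ge0 ac_ge0 (dot_ge0 (A *m u^T)).
  move=> ? ? ?; have : dot u^T u^T == 0 by apply/eqP; lra.
  by rewrite dot_eq0 trmx_eq0 => /eqP.
exists (invmx hess *m (ips_z s - a *: grad f (ips_xt L s))).
by rewrite /slope mulKVmx // addrAC subrK subrr.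
Qed.

Let argmin_aux : slope (argmin g) = 0.
Proof.
have [zs zs0] := slope_zero.
rewrite (@argmin_unique _ _ g 2^-1 zs) // => z.
have -> : g z = g (zs + (z - zs)) by rewrite addrC subrK.
rewrite aux_expansion zs0 dot0l addr0 lerD2l lerDl.
by rewrite mulr_ge0 ?dot_ge0.
Qed.

Lemma aux_strongly_convex z :
  g (argmin g) + 2^-1 * dot (z - argmin g) (z - argmin g) <= g z.
Proof.
have -> : g z = g (argmin g + (z - argmin g)) by rewrite addrC subrK.
rewrite aux_expansion argmin_aux dot0l addr0 lerD2l lerDl.
by rewrite mulr_ge0 ?dot_ge0.
Qed.

Let slopeE z : slope z = hess *m (z - argmin g).
Proof.
rewrite -[LHS]subr0 -argmin_aux /slope mulmxBr.
by rewrite opprD addrACA subrr addr0 opprB addrA subrK.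
Qed.

(** The left-hand side of the last hypothesis bounds
    Lb |u0 - zhat|^2 / (2 |z^k - zhat|^2): the starting point satisfies
    u0 - zhat = - 2 a c A^T A (z^k - zhat). *)
Lemma inner_stm_accurate (delta q : R) (t : nat) :
  let mu := penalty_curvature c lmin in
  let Lb := penalty_curvature c lmax in
  0 <= q -> Lb a * q ^+ 2 <= mu a ->
  Lb a / 2 * (2 * a * c * lmax) ^+ 2 <= delta * (1 + q) ^+ t ->
  ips_accurate f h L delta s (ips_inner f h L mu Lb s t.+1).
Proof.
move=> mu Lb q0 q_le delta_ge; rewrite /ips_accurate -/g sqr_enorm.
set zs := argmin g; set d := ips_z s - zs.
have lmin_gt0 : 0 < lmin by case: lminP.
have lmax_gt0 : 0 < lmax.
  by apply: lt_le_trans lmin_gt0 _; case: lminP => _ ev _; apply: lmaxP.2.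
pose V : set 'cV[R]_n := [set x | exists u, x - zs = A *m u].
have BE : 1 + 2 * a * c * lmax = Lb a by [].
have Lb0 : 0 < Lb a.
  by rewrite -BE ltr_pwDl // mulr_ge0 ?(ltW lmax_gt0) // -mulrA mulr_ge0.
have mu0 : 0 < mu a.
  rewrite /mu /penalty_curvature.
  by rewrite ltr_pwDl // mulr_ge0 ?(ltW lmin_gt0) // -mulrA mulr_ge0.
have gradE x : grad g x = x - zs + (2 * a * c) *: (A *m (A *m (x - zs))).
  by rewrite grad_aux slopeE hessE {1}symA -mulmxA.
have expand x y : g y = g x + dot (grad g x) (y - x) +
    (2^-1 * dot (y - x) (y - x) + a * c * dot (A *m (y - x)) (A *m (y - x))).
  by rewrite grad_aux -aux_expansion addrC subrK.
have := @stm_gap R n g (mu a) (Lb a) V (ips_z s - grad g (ips_z s)) zs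
  mu0 Lb0 _ _ _ _ _ _ _ q t q0 q_le.
have start : ips_z s - grad g (ips_z s) - zs =
    A *m (- (2 * a * c) *: (A *m d)).
  rewrite gradE -/d -scalemxAr scaleNr opprD addrA /d addrAC.
  by rewrite opprB addrA -addrA addrC; apply/colP => i; rewrite !mxE; ring.
have start_le : dot (zs - (ips_z s - grad g (ips_z s)))
    (zs - (ips_z s - grad g (ips_z s))) <= (2 * a * c * lmax) ^+ 2 * dot d d.
  rewrite -opprB start dotNl dotNr opprK -scalemxAr dotZl dotZr.
  have := gram_le_max_eigenvalue (A *m d) lmaxP.
  have := ler_wpM2l (ltW lmax_gt0) (gram_le_max_eigenvalue d lmaxP).
  move=> le1 le2; have := le_trans le2 le1.
  move=> /(ler_wpM2l (sqr_ge0 (2 * a * c))) le3.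
  by move: le3; rewrite !expr2; lra.
move=> gap; have {gap} : (1 + q) ^+ t *
    (g (ips_inner f h L mu Lb s t.+1) - g zs) <=
    Lb a / 2 * dot (zs - (ips_z s - grad g (ips_z s)))
                   (zs - (ips_z s - grad g (ips_z s))).
  apply: gap.
  - move=> x y; rewrite (expand x y) lerD2l.
    have := ler_wpM2l ac_ge0 (gram_le_max_eigenvalue (y - x) lmaxP).
    by rewrite /Lb /penalty_curvature; lra.
  - move=> x y; rewrite (expand x y) lerDl addr_ge0 // mulr_ge0 ?dot_ge0 //.
  - move=> x [u xE]; rewrite (expand x zs) lerD2l.
    have zsE : zs - x = A *m (- u) by rewrite -opprB xE mulmxN.
    have := ler_wpM2l ac_ge0 (gram_ge_min_pos_eigenvalue (- u) symA lminP).
    by rewrite -zsE /mu /penalty_curvature; lra.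
  - move=> w; apply: le_trans (aux_strongly_convex w).
    by rewrite lerDl mulr_ge0 ?dot_ge0.
  - by rewrite /V /= start; eexists.
  - move=> k x y [u xE] [v yE]; exists (k *: u + (1 - k) *: v).
    rewrite mulmxDr -!scalemxAr -xE -yE.
    by apply/colP => i; rewrite !mxE; ring.
  - move=> x [u xE]; exists (u - (mu a)^-1 *: (u + (2 * a * c) *: (A *m (A *m u)))).
    rewrite addrAC gradE xE mulmxBr -scalemxAr mulmxDr -scalemxAr.
    by [].
move=> gap; have q1 : 0 < (1 + q) ^+ t by rewrite exprn_gt0 // ltr_pwDl.
rewrite -(ler_pM2l q1); apply: (le_trans gap).
have Lb2 : 0 <= Lb a / 2 by rewrite divr_ge0 // ltW.
apply: le_trans (ler_wpM2l Lb2 start_le) _.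
have := ler_wpM2r (dot_ge0 d) delta_ge; lra.
Qed.

Lemma ips_stops_exists (delta : R) mu Lb (m : nat) :
  ips_accurate f h L delta s (ips_inner f h L mu Lb s m) ->
  exists2 t, ips_stops f h L mu Lb delta s t & (t <= m)%N.
Proof.
move=> acc_m.
pose P t := `[< ips_accurate f h L delta s (ips_inner f h L mu Lb s t) >].
have exP : exists t, P t by exists m; apply/asboolP.
exists (ex_minn exP); case: ex_minnP => t /asboolP acc_t min_t; last first.
  by apply: min_t; apply/asboolP.
split=> // t' t't /asboolP/min_t; by rewrite leqNgt t't.
Qed.

End AuxiliaryProblem.

(** * The outer iteration *)

Lemma penalty_convex (R : realType) n (A : 'M[R]_n) (c al be : R)
    (x y : 'cV[R]_n) :
  0 <= c -> 0 <= al -> 0 < be ->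
  (al + be) * penalty A c ((al + be)^-1 *: (al *: x + be *: y)) <=
  al * penalty A c x + be * penalty A c y.
Proof.
move=> c0 al0 be0; rewrite /penalty !sqr_enorm -scalemxAr mulmxDr -!scalemxAr.
have := dot_ge0 (A *m x - A *m y).
move: (A *m x) (A *m y) => u v; rewrite !dotE (dotC v u) => uv0.
have s0 : 0 < al + be by rewrite ltr_wpDl.
rewrite -subr_ge0.
rewrite [leRHS](_ : _ =
  c * (al * be / (al + be)) * (dot u u - dot u v - (dot u v - dot v v))).
  rewrite mulr_ge0 //; first by rewrite !mulr_ge0 ?invr_ge0 ?(ltW s0) ?(ltW be0).
  lra.
by field; rewrite gt_eqF.
Qed.

Section OuterStep.
Variables (R : realType) (n : nat) (A : 'M[R]_n) (f : 'cV[R]_n -> R).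
Variables (L c : R) (xs : 'cV[R]_n).
Hypotheses (c_ge0 : 0 <= c) (L_gt0 : 0 < L).
Hypothesis convex_f : convex_function [set: 'cV[R]_n] f.
Hypothesis smooth_f : smooth L f.

Let h := penalty A c.
Let F := fun x => f x + h x.

(** The cost of replacing zhat by z' = zhat + e, with d = zhat - z and
    y = x* - z.  Young's inequality splits - <y, e> with weight 8 delta, so that
    its part in e is at most |d|^2 / 8; with |d|^2 / 16 from <d, e> / 2 this
    leaves |d|^2 / 16 for the terms of order delta |d|^2. *)
Let inexact_prox_error (delta : R) (y d e : 'cV[R]_n) :
  0 < delta -> 56 * delta <= 1 -> dot e e <= 2 * delta * dot d d ->
  2^-1 * dot (y - d - e) (y - d - e) - 2^-1 * dot (y - d) (y - d) +
    delta * dot d d - 4^-1 * dot (d + e) (d + e) <= 4 * delta * dot y y.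
Proof.
move=> delta0 delta_le ee.
have ye := dot_ge0 ((8 * delta) *: y + e).
have de := dot_ge0 (d - 4 *: e).
have dd := dot_ge0 d; have ee0 := dot_ge0 e.
have dd56 : 56 * delta * dot d d <= dot d d by rewrite ler_piMl.
have ye' : - dot y e <= 4 * delta * dot y y + 16^-1 * delta^-1 * dot e e.
  have d16 : 0 < 16 * delta by lra.
  rewrite -(ler_pM2l d16).
  have -> : 16 * delta * (4 * delta * dot y y + 16^-1 * delta^-1 * dot e e) =
     64 * delta ^+ 2 * dot y y + dot e e by field; rewrite gt_eqF.
  by move: ye; rewrite !dotE (dotC e y); lra.
have ee' : delta^-1 * dot e e <= 2 * dot d d.
  by rewrite ler_pdivrMl //; lra.
have yy := mulr_ge0 (ltW delta0) (dot_ge0 y).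
move: de; rewrite !dotE (dotC d y) (dotC e y) (dotC e d); lra.
Qed.

(** Compared with the analysis of the exact method, smoothness with step constant
    2 L leaves |z' - z|^2 / 4, which absorbs the inexactness. *)
Lemma ips_step_descent (delta : R) (s : ips_state R n) (z' : 'cV[R]_n) :
  0 <= ips_A s -> 0 < delta -> 56 * delta <= 1 ->
  ips_accurate f h L delta s z' ->
  let a := ips_alpha L s in
  let x' := (ips_A s + a)^-1 *: (ips_A s *: ips_x s + a *: z') in
  (ips_A s + a) * (F x' - F xs) + 2^-1 * dot (xs - z') (xs - z') <=
  ips_A s * (F (ips_x s) - F xs) +
    (1 + 8 * delta) * (2^-1 * dot (xs - ips_z s) (xs - ips_z s)).
Proof.
move=> A0 delta0 delta_le acc; cbv zeta.
set a := ips_alpha L s; set x' := _^-1 *: (_ + a *: z').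
have [a0 aE] := step_sizeP (lexx 0) (mulr_gt0 (ltr0Sn R 1) L_gt0) A0.
rewrite -/(ips_alpha L s) -/a mulr0 addr0 mulr1 in a0 aE.
move: acc; rewrite /ips_accurate sqr_enorm.
have strong := aux_strongly_convex A f c_ge0 L_gt0 A0.
have := strong xs; have := strong z'.
set g := ips_g _ _ _ _; set zh := argmin g.
have gE z : g z = 2^-1 * dot (ips_z s - z) (ips_z s - z) + a * (f (ips_xt L s) +
  dot (grad f (ips_xt L s)) (z - ips_xt L s) + h z) by rewrite /g /ips_g sqr_enorm.
have xtE : (ips_A s + a) *: ips_xt L s = ips_A s *: ips_x s + a *: ips_z s.
  by rewrite scalerA mulfV ?scale1r // gt_eqF // ltr_wpDl.
move: gE xtE; set xt := ips_xt L s; set G := grad f xt; clearbody xt.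
move=> gE xtE strong_z' strong_xs acc.
have A'0 : 0 < ips_A s + a by rewrite ltr_wpDl.
have A'_neq0 : ips_A s + a != 0 by rewrite gt_eqF.
set d := zh - ips_z s; set e := z' - zh; set y := xs - ips_z s.
have ee : dot e e <= 2 * delta * dot d d.
  by rewrite /d -[zh - _]opprB dotNl dotNr opprK /e; lra.
have err := inexact_prox_error y delta0 delta_le ee.
have yde : y - d - e = xs - z' by apply/colP => i; rewrite !mxE; ring.
have yd : y - d = xs - zh by apply/colP => i; rewrite !mxE; ring.
have deE : d + e = z' - ips_z s by apply/colP => i; rewrite !mxE; ring.
rewrite yde yd deE in err.
have [df _] := smooth_f.
have x'xt : x' - xt = (a / (ips_A s + a)) *: (z' - ips_z s).
  apply: (scalerI A'_neq0); rewrite scalerBr xtE scalerA mulfV // scale1r scalerA.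
  by rewrite mulrC divfK // scalerBr opprD addrACA subrr add0r.
have Gcomb : ips_A s * dot G (ips_x s - xt) + a * dot G (z' - xt) =
    a * dot G (z' - ips_z s).
  rewrite -!dotZr -dotDr; congr dot.
  rewrite !scalerBr addrACA -opprD -scalerDl xtE.
  by rewrite opprD addrACA subrr add0r.
have fx' : (ips_A s + a) * f x' <= (ips_A s + a) * f xt +
    a * dot G (z' - ips_z s) + 4^-1 * dot (z' - ips_z s) (z' - ips_z s).
  have := ler_wpM2l (ltW A'0) (smooth_le_quadratic xt x' (ltW L_gt0) smooth_f).
  move/le_trans; apply; rewrite x'xt !dotZr dotZl -/G le_eqVlt.
  apply/orP; left; apply/eqP.
  have -> : 4^-1 = L * a ^+ 2 / (ips_A s + a) / 2.
    by rewrite aE; field; rewrite !gt_eqF.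
  by field.
have fx := ler_wpM2l A0 (convex_ge_tangent (ips_x s) convex_f (df xt)).
have fxs := ler_wpM2l (ltW a0) (convex_ge_tangent xs convex_f (df xt)).
have hx' := penalty_convex A (ips_x s) z' c_ge0 A0 a0.
rewrite -/h -/x' in hx'.
rewrite -/G in fx fxs.
move: strong_z' strong_xs acc; rewrite !(gE z') !(gE xs).
rewrite -[ips_z s - zh]opprB -/d -[ips_z s - z']opprB -[ips_z s - xs]opprB -/y.
rewrite !dotNl !dotNr !opprK /F => strong_z' strong_xs acc; clearbody x' d e y zh; lra.
Qed.
End OuterStep.

(** With b = 2 L alpha_{k+1} the step equation reads b^2 - b = 2 L A_k, hence b
    lies between (k + 1) / 2 and k + 1 as soon as 2 L A_k lies between k^2 / 4
    and k^2. *)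
Lemma ips_weight_bounds (R : realType) n (f h : 'cV[R]_n -> R) (L : R) mu Lb x0
    T (k : nat) :
  0 < L ->
  let s := stm_ips f h L mu Lb x0 T k in
  [/\ 0 <= ips_A s, k%:R ^+ 2 <= 8 * L * ips_A s,
      2 * L * ips_A s <= k%:R ^+ 2 & 2 * L * ips_alpha L s <= k.+1%:R].
Proof.
move=> L0 s.
have step (s' : ips_state R n) (j : nat) : 0 <= ips_A s' ->
    j%:R ^+ 2 <= 8 * L * ips_A s' -> 2 * L * ips_A s' <= j%:R ^+ 2 ->
    [/\ 0 < ips_alpha L s', 2 * L * ips_alpha L s' <= j.+1%:R &
    2 * L * (ips_A s' + ips_alpha L s') = (2 * L * ips_alpha L s') ^+ 2 /\
    j.+1%:R <= 2 * (2 * L * ips_alpha L s')].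
  move=> A0 lowA upA.
  have [a0 aE] := step_sizeP (lexx 0) (mulr_gt0 (ltr0Sn R 1) L0) A0.
  rewrite -/(ips_alpha L s') mulr0 addr0 mulr1 in a0 aE.
  move: a0 aE; set a := ips_alpha _ _ => a0 aE.
  have b0 : 0 < 2 * L * a by rewrite !mulr_gt0.
  have bE : 2 * L * (ips_A s' + a) = (2 * L * a) ^+ 2 by rewrite aE; ring.
  have : 2 * L * ips_A s' = (2 * L * a) ^+ 2 - 2 * L * a by rewrite -bE; ring.
  move: b0 bE; set b := 2 * L * a => b0 bE AE.
  have j0 : 0 <= j%:R :> R by [].
  rewrite -natr1; split=> //; first by rewrite leNgt; apply/negP => lt; nra.
  split=> //; rewrite leNgt; apply/negP => lt.
  by have [?|?] := leP 1 (2 * b); nra.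
elim: k @s => [|k IHk] /=.
  rewrite expr0n /= !mulr0; split=> //.
  have [] // := step (ips_init x0) 0; rewrite /= ?expr0n ?mulr0 //.
set s := stm_ips _ _ _ _ _ _ _ k in IHk *.
have [A0 lowA upA _] := IHk; have [a0 up [bE low]] := step s k A0 lowA upA.
have b0 : 0 <= 2 * (2 * L * ips_alpha L s) by rewrite !mulr_ge0 // ltW.
set s' := ips_step _ _ _ _ _ _ _.
have A'0 : 0 <= ips_A s' by rewrite addr_ge0 // ltW.
have lowA' : k.+1%:R ^+ 2 <= 8 * L * ips_A s'.
  have -> : 8 * L * ips_A s' = (2 * (2 * L * ips_alpha L s)) ^+ 2.
    by rewrite exprMn -bE /=; ring.
  by rewrite lerXn2r ?nnegrE.
have upA' : 2 * L * ips_A s' <= k.+1%:R ^+ 2.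
  by rewrite bE lerXn2r ?nnegrE // !mulr_ge0 // ltW.
by split=> //; have [] := step s' k.+1 A'0 lowA' upA'.
Qed.

(** The gap at x^k is nonnegative as xs is a minimizer, so the factor 1 + 8 delta
    on the distance may be put on the whole energy. *)
Lemma ips_energy_le (R : realType) n (A : 'M[R]_n) (f : 'cV[R]_n -> R)
    (L c delta : R) mu Lb (x0 xs : 'cV[R]_n) T (N : nat) :
  0 <= c -> 0 < L -> convex_function [set: 'cV[R]_n] f -> smooth L f ->
  is_argmin (fun x => f x + penalty A c x) xs ->
  0 < delta -> 56 * delta <= 1 ->
  stm_ips_run f (penalty A c) L mu Lb delta x0 T N ->
  let F := fun x => f x + penalty A c x in
  let s := stm_ips f (penalty A c) L mu Lb x0 T N in
  ips_A s * (F (ips_x s) - F xs) + 2^-1 * dot (xs - ips_z s) (xs - ips_z s) <=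
  (1 + 8 * delta) ^+ N * (2^-1 * dot (xs - x0) (xs - x0)).
Proof.
move=> c0 L0 convex_f smooth_f xs_min delta0 delta_le run; cbv zeta.
set F := fun x => f x + penalty A c x.
have [S SE] : exists S, S = stm_ips f (penalty A c) L mu Lb x0 T by eexists.
rewrite -SE; suff main k : (k <= N)%N ->
    ips_A (S k) * (F (ips_x (S k)) - F xs) +
      2^-1 * dot (xs - ips_z (S k)) (xs - ips_z (S k)) <=
    (1 + 8 * delta) ^+ k * (2^-1 * dot (xs - x0) (xs - x0)) by exact: main.
elim: k => [|k IHk] kN; first by rewrite SE /= mul0r add0r mul1r.
have {}IHk := IHk (ltnW kN); have [acc _] := run k kN.
have [A0 _ _ _] := ips_weight_bounds f (penalty A c) mu Lb x0 T k L0.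
rewrite -SE in acc A0.
have := ips_step_descent xs c0 L0 convex_f smooth_f A0 delta0 delta_le acc.
cbv zeta.
have -> : S k.+1 = ips_step f (penalty A c) L mu Lb (S k) (T k) by rewrite SE.
move=> /le_trans; apply.
have gap0 : 0 <= ips_A (S k) * (F (ips_x (S k)) - F xs).
  by rewrite mulr_ge0 // subr_ge0; exact: xs_min.
have gap8 := mulr_ge0 (ltW delta0) gap0.
have d8 : 0 <= 1 + 8 * delta by lra.
rewrite exprS -(mulrA (1 + 8 * delta)); apply: le_trans (ler_wpM2l d8 IHk).
rewrite [leRHS]mulrDr lerD2r; move: gap8; rewrite /F; lra.
Qed.

Lemma ips_nfE (R : realType) n (f h : 'cV[R]_n -> R) (L : R) mu Lb x0 T k :
  ips_nf (stm_ips f h L mu Lb x0 T k) = k.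
Proof. by elim: k => //= k ->. Qed.

Lemma ips_nh_le (R : realType) n (f h : 'cV[R]_n -> R) (L : R) mu Lb x0 T
    (m k : nat) :
  (forall j, (j < k)%N -> (T j < m)%N) ->
  (ips_nh (stm_ips f h L mu Lb x0 T k) <= k * m)%N.
Proof.
elim: k => //= k IHk T_lt; rewrite mulSn addnC leq_add ?T_lt //.
by apply: IHk => j jk; apply: T_lt; exact: ltnW.
Qed.

(** A rule that picks the number of inner iterations from the current state
    determines a schedule, as the k-th state only depends on the earlier
    entries. *)
Lemma exists_schedule (R : realType) n (f h : 'cV[R]_n -> R) (L : R) mu Lb x0
    (pick : ips_state R n -> nat) :
  exists T, forall k, T k = pick (stm_ips f h L mu Lb x0 T k).
Proof.
pose S k := iter k (fun s => ips_step f h L mu Lb s (pick s)) (ips_init x0).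
exists (fun k => pick (S k)) => k; congr pick.
by elim: k => //= k <-.
Qed.

(** * Real estimates *)

Lemma expR_half_le (R : realType) (q : R) :
  0 <= q -> q <= 1 -> expR (q / 2) <= 1 + q.
Proof.
move=> q0 q1; rewrite -[q / 2]opprK expRN.
have e1 : 1 - q / 2 <= expR (- (q / 2)) := expR_ge1Dx _.
have pos : 0 < 1 - q / 2 by lra.
apply: (@le_trans _ _ (1 - q / 2)^-1); first by rewrite lef_pV2 ?posrE ?expR_gt0.
rewrite -[_^-1]mul1r ler_pdivrMr //; nra.
Qed.

Lemma pow_le_geometric (R : realType) (q S : R) (m t : nat) :
  0 <= q -> q <= 1 -> 0 < S -> 2 * m%:R * ln S <= q * t%:R ->
  S ^+ m <= (1 + q) ^+ t.
Proof.
move=> q0 q1 S0 mt.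
apply: (@le_trans _ _ (expR (q / 2) ^+ t)); last first.
  by rewrite lerXn2r ?nnegrE ?expR_ge0 ?addr_ge0 // expR_half_le.
rewrite -[S in S ^+ m]lnK ?posrE // -!expRM_natl ler_expR; lra.
Qed.

Lemma half_le_ln (R : realType) (S : R) : 2 <= S -> 2^-1 <= ln S.
Proof.
move=> S2; rewrite -ler_expR lnK ?posrE; last exact: lt_le_trans S2.
have := @expR_half_le R 1 ler01 (lexx 1); rewrite mul1r; lra.
Qed.

Lemma pow_accuracy_le (R : realType) (delta : R) (N : nat) :
  0 < delta -> 64 * delta * N%:R <= 1 -> (1 + 8 * delta) ^+ N <= 2.
Proof.
move=> d0 dN; have d8 : 1 + 8 * delta <= expR (8 * delta) := expR_ge1Dx _.
apply: (@le_trans _ _ (expR (8 * delta) ^+ N)).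
  by rewrite lerXn2r ?nnegrE ?expR_ge0 // addr_ge0 // mulr_ge0 // ltW.
rewrite -expRM_natl; apply: (@le_trans _ _ (expR (1 / 2))).
  by rewrite ler_expR; lra.
have := @expR_half_le R 1 ler01 (lexx 1); lra.
Qed.

Lemma trunc_succ_le (R : realType) (x : R) : 0 <= x ->
  x <= (Num.truncn x).+1%:R /\ (Num.truncn x).+1%:R <= x + 1.
Proof.
move=> /truncn_itv /andP[le_x lt_x]; split; first exact: ltW.
by rewrite -natr1 lerD2r.
Qed.

(** The condition number of the auxiliary problem is at most lmax / lmin,
    uniformly in the step a. *)
Lemma curvature_ratio (R : realType) (c lmax lmin a : R) :
  0 <= a * c -> 0 < lmin -> lmin <= lmax ->
  penalty_curvature c lmax a * Num.sqrt (lmin / lmax) ^+ 2 <=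
  penalty_curvature c lmin a.
Proof.
move=> ac0 lmin0 lmin_max; have lmax0 := lt_le_trans lmin0 lmin_max.
rewrite sqr_sqrtr ?divr_ge0 ?(ltW lmax0) ?(ltW lmin0) // /penalty_curvature.
have le1 : lmin / lmax <= 1 by rewrite ler_pdivrMr // mul1r.
have -> : (1 + 2 * a * c * lmax) * (lmin / lmax) =
    lmin / lmax + 2 * a * c * lmin by field; rewrite gt_eqF.
lra.
Qed.

Lemma sqrt_le_max1 (R : realType) (X : R) :
  3 * Num.sqrt X + 1 <= 4 * Num.max 1 (Num.sqrt X).
Proof. by rewrite maxEle; case: ifP => [|/negbT]; rewrite -?ltNge; lra. Qed.

(** B stands for 2 a c lmax, W for Ry^2 lmax / (L eps), X for L R0^2 / eps and S
    for the argument of the logarithm.  Up to constants the ratio of the two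
    sides without S is at most N (1 + B)^3, where N <= 4 S and 1 + B <= 5 S^2; the
    constants are absorbed in S^14 since S^7 >= 2^7. *)
Lemma inner_target_le (R : realType) (N B W X S : R) :
  0 <= B -> 0 <= W -> 0 <= X -> 1 <= N -> B <= N * W ->
  N <= 4 * Num.max 1 (Num.sqrt X) -> 2 + X + W <= S ->
  (1 + B) / 2 * B ^+ 2 <= (64 * N)^-1 * S ^+ 21.
Proof.
move=> B0 W0 X0 N1 BNW N_le S_ge.
have S2 : 2 <= S by lra.
have NS : N <= 4 * S.
  apply: le_trans N_le _; rewrite ler_pM2l // ge_max; apply/andP; split; first by lra.
  have sX := sqrtr_ge0 X; have : Num.sqrt X ^+ 2 = X by rewrite sqr_sqrtr.
  nra.
have B1S : 1 + B <= 5 * S ^+ 2.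
  have : N * W <= 4 * S * S by apply: ler_pM => //; lra.
  nra.
have N0 : 0 < 64 * N by lra.
rewrite ler_pdivlMl //.
have cube : (1 + B) * B ^+ 2 <= (5 * S ^+ 2) ^+ 3.
  apply: (@le_trans _ _ ((1 + B) ^+ 3)).
    rewrite (exprS (1 + B) 2) ler_pM2l; last by lra.
    by apply: lerXn2r; rewrite ?nnegrE; lra.
  by rewrite lerXn2r ?nnegrE ?mulr_ge0 ?sqr_ge0 //; lra.
have S7 : 128 <= S ^+ 7.
  apply: (@le_trans _ _ (2 ^+ 7)); first by lra.
  by apply: lerXn2r; rewrite ?nnegrE; lra.
apply: (@le_trans _ _ (32 * (4 * S) * (5 * S ^+ 2) ^+ 3)).
  have -> : 64 * N * ((1 + B) / 2 * B ^+ 2) = 32 * N * ((1 + B) * B ^+ 2) by field.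
  by apply: ler_pM; [lra|apply: mulr_ge0; [lra|exact: sqr_ge0]|lra|].
have -> : 32 * (4 * S) * (5 * S ^+ 2) ^+ 3 = 128 * (125 * S ^+ 7) by ring.
have -> : S ^+ 21 = S ^+ 7 * (S ^+ 7 * S ^+ 7) by rewrite -!exprD.
have S7_0 : 0 <= S ^+ 7 by lra.
have S14 : 125 * S ^+ 7 <= S ^+ 7 * S ^+ 7 by apply: ler_wpM2r; lra.
by apply: ler_pM; lra.
Qed.

Theorem theorem4p2 (R : realType) :
  exists (C : R) (p : nat), 0 < C /\
  forall (n : nat) (A : 'M[R]_n) (f : 'cV[R]_n -> R)
    (L eps lmax lmin : R) (ystar x0 xstar : 'cV[R]_n),
    psd A ->
    (exists2 v : 'cV[R]_n, v != 0 & A *m v = 0) ->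
    is_max_eigenvalue (A^T *m A) lmax ->
    is_min_pos_eigenvalue (A^T *m A) lmin ->
    convex_function [set: 'cV[R]_n] f ->
    0 < L ->
    smooth L f ->
    min_norm_dual_solution f A ystar ->
    0 < eps ->
    let Ry := enorm ystar in
    let c := Ry ^+ 2 / eps in
    let h := penalty A c in
    let F := fun x => f x + h x in
    closest_minimizer F x0 xstar ->
    let R0 := enorm (x0 - xstar) in
    let chi := lmax / lmin in
    let mu := penalty_curvature c lmin in
    let Lb := penalty_curvature c lmax in
    exists (N : nat) (delta : R) (T : nat -> nat),
      let out := stm_ips f h L mu Lb x0 T N in
      [/\ 0 < delta,
          stm_ips_run f h L mu Lb delta x0 T N,
          F (ips_x out) - F xstar <= eps,
          (ips_nf out)%:R <= C * Num.max 1 (Num.sqrt (L * R0 ^+ 2 / eps)) &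
          (ips_nh out)%:R <=
            C * Num.max (Num.sqrt chi) (Num.sqrt (L * R0 ^+ 2 / eps * chi)) *
            ln (2 + L * R0 ^+ 2 / eps + Ry ^+ 2 * lmax / (L * eps) + chi) ^+ p].
Proof.
exists 192, 1%N; split=> [|n A f L eps lmax lmin ystar x0 xstar]; first by lra.
move=> [symA _] _ lmaxP lminP convex_f L0 smooth_f _ eps0.
move=> Ry c h F [xs_min _] R0 chi mu Lb.
set X := L * R0 ^+ 2 / eps; set W := Ry ^+ 2 * lmax / (L * eps).
set S := 2 + X + W + chi.
have lmin_gt0 : 0 < lmin by case: lminP.
have lmin_max : lmin <= lmax by case: lminP => _ ev _; apply: lmaxP.2.
have lmax_gt0 := lt_le_trans lmin_gt0 lmin_max.
have c0 : 0 <= c by rewrite /c divr_ge0 ?sqr_ge0 ?(ltW eps0).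
have X0 : 0 <= X := divr_ge0 (mulr_ge0 (ltW L0) (sqr_ge0 R0)) (ltW eps0).
have W0 : 0 <= W := divr_ge0 (mulr_ge0 (sqr_ge0 Ry) (ltW lmax_gt0))
  (mulr_ge0 (ltW L0) (ltW eps0)).
have chi1 : 1 <= chi by rewrite ler_pdivlMr // mul1r.
have sX0 := sqrtr_ge0 X.
set q := Num.sqrt (lmin / lmax).
have q0 : 0 <= q := sqrtr_ge0 _.
have q1 : q <= 1.
  by rewrite -sqrtr1 ler_sqrt ?ltr01 // ler_pdivrMr // mul1r.
have chi_q : q * Num.sqrt chi = 1.
  rewrite /q -sqrtrM ?divr_ge0 ?(ltW lmin_gt0) ?(ltW lmax_gt0) //.
  have -> : lmin / lmax * chi = 1 by rewrite /chi; field; rewrite !gt_eqF.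
  exact: sqrtr1.
have schi1 : 1 <= Num.sqrt chi by rewrite -[leLHS]sqrtr1 ler_sqrt // (le_trans ler01).
have lnS : 2^-1 <= ln S by apply: half_le_ln; rewrite /S; lra.
have [N [N1 N_ge N_le]] : exists N : nat, [/\ 1 <= N%:R :> R,
    3 * Num.sqrt X <= N%:R & N%:R <= 3 * Num.sqrt X + 1].
  have [ge le] := trunc_succ_le (mulr_ge0 (ler0n R 3) sX0).
  by exists (Num.truncn (3 * Num.sqrt X)).+1; split; rewrite ?ler1n.
have N_max := le_trans N_le (sqrt_le_max1 X).
(* The energy at most doubles over N iterations. *)
have [delta deltaE] : exists delta : R, delta = (64 * N%:R)^-1 by eexists.
have deltaN : delta * (64 * N%:R) = 1.
  by rewrite deltaE mulVf // gt_eqF // mulr_gt0 // (lt_le_trans ltr01).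
have delta0 : 0 < delta by rewrite deltaE invr_gt0 mulr_gt0 // (lt_le_trans ltr01).
have delta56 : 56 * delta <= 1.
  have := ler_wpM2l (ltW delta0) N1; clear -deltaN delta0; lra.
have energy_factor : (1 + 8 * delta) ^+ N <= 2.
  by apply: pow_accuracy_le; rewrite // (mulrC 64) -mulrA deltaN.
(* (1 + q)^t >= S^21 for this t. *)
have [t [t_ge t_le]] : exists t : nat, 42 * (Num.sqrt chi * ln S) <= t%:R /\
    t%:R <= 42 * (Num.sqrt chi * ln S) + 1.
  exists (Num.truncn (42 * (Num.sqrt chi * ln S))).+1; apply: trunc_succ_le.
  rewrite mulr_ge0 // mulr_ge0 ?sqrtr_ge0 //; clear -lnS; lra.
pose good s : set nat :=
  [set j | ips_stops f h L mu Lb delta s j /\ (j <= t.+1)%N].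
pose pick s := xget 0%N (good s).
have [T TE] := exists_schedule f h L mu Lb x0 pick.
have inner k : (k < N)%N ->
    ips_stops f h L mu Lb delta (stm_ips f h L mu Lb x0 T k) (T k) /\ (T k <= t.+1)%N.
  move=> kN; have [A0 _ _ a_le] := ips_weight_bounds f h mu Lb x0 T k L0.
  rewrite TE; move: A0 a_le; set s := stm_ips _ _ _ _ _ _ _ _ => A0 a_le.
  apply: (@xgetPex _ 0%N (good s)).
  have [a0 _] := step_sizeP (lexx 0) (mulr_gt0 (ltr0Sn R 1) L0) A0.
  rewrite -/(ips_alpha L s) in a0.
  have ac0 : 0 <= ips_alpha L s * c by rewrite mulr_ge0 // ltW.
  have acc : ips_accurate f h L delta s (ips_inner f h L mu Lb s t.+1).
    have := @inner_stm_accurate _ _ _ f _ _ _ _ s symA c0 L0 A0 lmaxP lminP delta q t q0.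
    cbv zeta; apply.
      exact: curvature_ratio.
    set B := 2 * ips_alpha L s * c * lmax.
    have B0 : 0 <= B by rewrite /B -(mulrA 2) mulr_ge0 ?(ltW lmax_gt0) // mulr_ge0.
    have BNW : B <= N%:R * W.
      have -> : B = 2 * L * ips_alpha L s * W.
        by rewrite /B /W /c; field; rewrite !gt_eqF.
      apply: ler_wpM2r => //; apply: le_trans a_le _; by rewrite ler_nat.
    have S_ge : 2 + X + W <= S by rewrite /S; lra.
    apply: le_trans (inner_target_le B0 W0 X0 N1 BNW N_max S_ge) _.
    rewrite -deltaE ler_pM2l //; apply: pow_le_geometric => //.
      by rewrite /S; lra.
    apply: le_trans (ler_wpM2l q0 t_ge).
    have -> : q * (42 * (Num.sqrt chi * ln S)) = 42 * (q * Num.sqrt chi) * ln S.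
      by ring.
    rewrite chi_q; lra.
  by have [j stops_j j_le] := ips_stops_exists acc; exists j; split.
have run : stm_ips_run f h L mu Lb delta x0 T N by move=> k /inner[].
exists N, delta, T; cbv zeta; split=> //.
- have := ips_energy_le c0 L0 convex_f smooth_f xs_min delta0 delta56 run.
  cbv zeta; have [A0 A_ge _ _] := ips_weight_bounds f h mu Lb x0 T N L0.
  move: A0 A_ge; rewrite -/h; set s := stm_ips _ _ _ _ _ _ _ _ => A0 A_ge energy.
  have xsx0 : dot (xstar - x0) (xstar - x0) = R0 ^+ 2.
    by rewrite sqr_enorm -opprB dotNl dotNr opprK.
  rewrite xsx0 in energy.
  have z0 : 0 <= 2^-1 * dot (xstar - ips_z s) (xstar - ips_z s).
    by rewrite mulr_ge0 ?dot_ge0.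
  have R2 : 0 <= 2^-1 * R0 ^+ 2 by rewrite mulr_ge0 ?sqr_ge0.
  have gapA : ips_A s * (F (ips_x s) - F xstar) <= R0 ^+ 2.
    have := ler_wpM2r R2 energy_factor; rewrite /F; lra.
  have N2 : 9 * X <= N%:R ^+ 2.
    have : (3 * Num.sqrt X) ^+ 2 <= N%:R ^+ 2 by rewrite lerXn2r ?nnegrE ?mulr_ge0.
    by rewrite exprMn sqr_sqrtr //; lra.
  have N2_gt0 : 0 < N%:R ^+ 2 :> R by rewrite exprn_gt0 //; lra.
  have A_gt0 : 0 < ips_A s.
    have : 0 < 8 * L * ips_A s by exact: lt_le_trans A_ge.
    by rewrite pmulr_rgt0 // mulr_gt0.
  rewrite -(ler_pM2l A_gt0); apply: (le_trans gapA).
  have XE : X * eps = L * R0 ^+ 2 by rewrite /X divfK // gt_eqF.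
  have L8 : 0 < 8 * L by rewrite mulr_gt0.
  rewrite -(ler_pM2l L8).
  have : 8 * (X * eps) <= 8 * L * ips_A s * eps.
    rewrite mulrA ler_pM2r //; lra.
  rewrite XE; lra.
- rewrite ips_nfE; apply: (le_trans N_max).
  have : 1 <= Num.max 1 (Num.sqrt X) by rewrite le_max lexx.
  lra.
- have nh_le : (ips_nh (stm_ips f h L mu Lb x0 T N) <= N * t.+2)%N.
    by apply: ips_nh_le => j /inner[_]; rewrite ltnS.
  apply: (@le_trans _ _ (N * t.+2)%:R); first by rewrite ler_nat.
  rewrite natrM expr1.
  have t_bound : t.+2%:R <= 48 * (Num.sqrt chi * ln S).
    have : 2^-1 <= Num.sqrt chi * ln S by nra.
    rewrite -(natr1 t.+1) -(natr1 t); lra.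
  have -> : Num.max (Num.sqrt chi) (Num.sqrt (X * chi)) =
      Num.max 1 (Num.sqrt X) * Num.sqrt chi.
    by rewrite maxr_pMl ?sqrtr_ge0 // mul1r (sqrtrM chi X0).
  apply: le_trans (ler_pM _ _ N_max t_bound) _ => //.
  by rewrite le_eqVlt; apply/orP; left; apply/eqP; ring.
Qed.
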